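(* Consider the one-dimensional OFDM signal $\mathbf{x}=\mathbf{F}_N^H\mathbf{s}$ of length $N$ with $L$ deterministic unit-amplitude pilots on an arbitrary index set $I\subseteq\mathbb{Z}_N$ and i.i.d. random data symbols on the remaining indices, as set out in the context. Then, for any pilot pattern $I$ and any unit-amplitude pilot symbols, and for every $q\in\mathbb{Z}_N$ with $q\neq 0$, $$\sum_{k=0}^{N-1}\mathbb{E}\left(|\mathcal{X}^{\mathrm{DP}}(k,q)|^2\right)=N^2.$$
   Context: Let $j$ be the imaginary unit, $N\ge 1$, $0\le L\le N$, $\mathbb{Z}_N=\{0,1,\dots,N-1\}$, and $\langle\cdot\rangle_N$ denote reduction modulo $N$. Indices start from $0$. $\mathbf{F}_N$ is the normalized DFT matrix with entries $(\mathbf{F}_N)_{m,n}=\frac{1}{\sqrt N}e^{-j2\pi mn/N}$. Signal model. $I\subseteq\mathbb{Z}_N$ is a set with $L$ elements (pilot pattern). The symbol vector $\mathbf{s}\in\mathbb{C}^N$ has deterministic pilot entries $s_i$ with $|s_i|=1$ for $i\in I$ (unit-amplitude pilots), while the entries $s_i$, $i\notin I$, are i.i.d. random data symbols, each distributed as a complex random variable $d$ with finite fourth moment and $$\mathbb{E}(d)=0,\quad \mathbb{E}(|d|^2)=1,\quad \mathbb{E}(d^2)=0,\quad \mathbb{E}(d|d|^2)=\mathbb{E}(d^*|d|^2)=0.$$ Ambiguity function. $\mathbf{R}_{N,k}$ is the cyclic shift, $(\mathbf{R}_{N,k}\mathbf{x})_n=x_{\langle n-k\rangle_N}$, and $\mathbf{\Phi}_{N,q}=\mathrm{Diag}(1,e^{j2\pi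 q/N},\dots,e^{j2\pi q(N-1)/N})$. The discrete periodic ambiguity function (DP-AF) is $\mathcal{X}^{\mathrm{DP}}(k,q)=\mathbf{x}^H\mathbf{R}_{N,k}^T\mathbf{\Phi}_{N,q}^*\mathbf{x}$ with $\mathbf{x}=\mathbf{F}_N^H\mathbf{s}$, for $(k,q)\in\mathbb{Z}_N^2$. *)

(* Defs.v *)
From HB Require Import structures.
From mathcomp Require Export all_boot all_order all_algebra.
From mathcomp Require Export complex.
From mathcomp Require Export all_classical all_reals all_analysis.

Set Implicit Arguments.
Unset Strict Implicit.
Unset Printing Implicit Defensive.

Import Order.TTheory GRing.Theory Num.Theory.
Import numFieldNormedType.Exports.
Export ComplexField.Normc.

Local Open Scope classical_set_scope.
Local Open Scope ring_scope.
Local Open Scope complex_scope.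

Definition expi (R : realType) (x : R) : R[i] := cos x +i* sin x.

Section complex_random_variables.
Context d (T : measurableType d) (R : realType) (P : probability T R).

(* A complex number is identified with the pair of its real and imaginary
   parts, so the measurable sets are the Borel sets of R * R. *)
Definition reim (X : T -> R[i]) :
    T -> (measurableTypeR R * measurableTypeR R)%type :=
  fun t => (complex.Re (X t), complex.Im (X t)).

Definition complex_rv (X : T -> R[i]) : Prop :=
  measurable_fun [set: T] (reim X).

(* [fine] maps infinite values to 0: this is the usual expectation only when
   the real and imaginary parts of X are integrable. *)
Definition cexpectation (X : T -> R[i]) : R[i] :=
  fine ('E_P[fun t => complex.Re (X t)])
    +i* fine ('E_P[fun t => complex.Im (X t)]).

Definition mutually_independent (I : finType) (D : {set I})
    (X : I -> T -> R[i]) : Prop :=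
  forall (J : {set I})
    (A : I -> set (measurableTypeR R * measurableTypeR R)%type),
    (J \subset D)%SET -> (forall i, measurable (A i)) ->
    (P (\bigcap_(i in [set` J]) (reim (X i) @^-1` A i)) =
     \prod_(i in J) P (reim (X i) @^-1` A i))%E.

End complex_random_variables.

Definition same_distribution d1 (T1 : measurableType d1) d2
    (T2 : measurableType d2) (R : realType)
    (P1 : probability T1 R) (P2 : probability T2 R)
    (X1 : T1 -> R[i]) (X2 : T2 -> R[i]) : Prop :=
  forall A : set (measurableTypeR R * measurableTypeR R)%type, measurable A ->
    pushforward P1 (reim X1) A = pushforward P2 (reim X2) A.

Section ambiguity_function.
Variables (R : realType) (N : nat).

Definition dft_mx : 'M[R[i]]_N :=
  \matrix_(m, n) (((Num.sqrt N%:R)^-1)%:C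
                    * expi (- (2 * pi * m%:R * n%:R / N%:R))).

Definition shift_mx (k : 'I_N) : 'M[R[i]]_N :=
  \matrix_(n, m) (m%:Z == ((n%:Z - k%:Z) %% N%:Z)%Z)%:R.

Definition doppler_mx (q : 'I_N) : 'M[R[i]]_N :=
  diag_mx (\row_n expi (2 * pi * q%:R * n%:R / N%:R)).

Definition herm_tr m n (A : 'M[R[i]]_(m, n)) : 'M[R[i]]_(n, m) :=
  map_mx conjc A^T.

Definition ofdm (s : 'cV[R[i]]_N) : 'cV[R[i]]_N := herm_tr dft_mx *m s.

Definition dp_af (x : 'cV[R[i]]_N) (k q : 'I_N) : R[i] :=
  (herm_tr x *m (shift_mx k)^T *m map_mx conjc (doppler_mx q) *m x) 0 0.

End ambiguity_function.

(* Main.v *)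
(* In the frequency domain X(k,q) = sum_m conj(s_m) s_(m+q) e^(2 pi j m k / N),
   so Parseval's identity in k gives the pointwise equality
   sum_k |X(k,q)|^2 = N sum_m |s_m|^2 |s_(m+q)|^2.
   Since q <> 0, the indices m and m+q differ, so each product has expectation
   one, by independence when both are data and by unit amplitude otherwise. *)

Require Import Defs.
From HB Require Import structures.
From mathcomp Require Import measurable_realfun zify ring lra.

Set Implicit Arguments.
Unset Strict Implicit.
Unset Printing Implicit Defensive.

Import Order.TTheory GRing.Theory Num.Theory.
Import numFieldNormedType.Exports.

Local Open Scope classical_set_scope.
Local Open Scope ring_scope.
Local Open Scope complex_scope.

(** * Characters of the cyclic group of order [N] and their orthogonality *)

Section characters.
Context {R : realType}.
Implicit Types x y : R.

Lemma expiD x y : expi (x + y) = expi x * expi y.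
Proof. by rewrite /expi cosD sinD; simpc; congr (_ +i* _); ring. Qed.

Lemma expi0 : expi (0 : R) = 1.
Proof. by rewrite /expi cos0 sin0. Qed.

Lemma conjc_expi x : conjc (expi x) = expi (- x).
Proof. by rewrite /expi cosN sinN. Qed.

Lemma expiMn x n : expi (x *+ n) = expi x ^+ n.
Proof. by elim: n => [|n IH]; rewrite ?mulr0n ?expi0 // mulrS expiD IH exprS. Qed.

Lemma expi_2pi : expi (2 * pi : R) = 1.
Proof. by rewrite /expi mulrC mulr_natr cos2pi sin2pi. Qed.

(** By the half-angle formula the real part is [1 - 2 sin(x/2)^2], and [sin (x / 2)] is positive
    because [x / 2] lies strictly between 0 and [pi]. *)
Lemma expi_neq1 x : 0 < x < 2 * pi -> expi x != 1.
Proof.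
move=> /andP[x0 x2].
have s0 : 0 < sin (x / 2) by apply: sin_gt0_pi; apply/andP; split; lra.
apply/eqP => /(congr1 (@complex.Re R)) /=.
rewrite [x in cos x](_ : x = (x / 2) *+ 2); last by rewrite mulr2n; lra.
rewrite cos_mulr2n cos2sin2 => h.
by have := exprn_gt0 2 s0; lra.
Qed.

Lemma sqr_normcE (z : R[i]) : (normc z ^+ 2)%:C = z * conjc z.
Proof. by rewrite rmorphXn /= -[(normc z)%:C]/(`|z|) sqr_normc. Qed.

Lemma conjcM (z w : R[i]) : conjc (z * w) = conjc z * conjc w.
Proof. exact: rmorphM. Qed.

Variable n : nat.
(* For nonzero N, addition in 'I_N is addition modulo N. *)
Let N := n.+1.

(** A power of one fixed [N]-th root of unity, rather than an exponential of a real angle, so that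
    exponents can be reduced modulo [N]. *)
Definition chi (a b : 'I_N) : R[i] := expi (2 * pi / N%:R) ^+ (a * b).

Lemma expi_root_unity : expi (2 * pi / N%:R : R) ^+ N = 1.
Proof. by rewrite -expiMn -[_ *+ N]mulr_natr -mulrA mulVf ?pnatr_eq0 // mulr1 expi_2pi. Qed.

Lemma chiE (a b : 'I_N) : expi (2 * pi * a%:R * b%:R / N%:R) = chi a b.
Proof.
rewrite /chi -expiMn; congr expi; rewrite -[_ *+ (a * b)]mulr_natr natrM; field.
by rewrite pnatr_eq0.
Qed.

Lemma chiC a b : chi a b = chi b a.
Proof. by rewrite /chi mulnC. Qed.

(** The sum [a + b] wraps around modulo [N]; this is harmless because the base of the power is an
    [N]-th root of unity. *)
Lemma chiDl (a b c : 'I_N) : chi (a + b) c = chi a c * chi b c.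
Proof.
rewrite /chi -exprD -mulnDl !(mulnC _ c) !exprM.
by rewrite expr_mod // exprAC expi_root_unity expr1n.
Qed.

Lemma chi0l c : chi 0 c = 1.
Proof. by rewrite /chi mul0n expr0. Qed.

Lemma conjc_chi a b : conjc (chi a b) * chi a b = 1.
Proof.
by rewrite -chiE conjc_expi -expiD addNr expi0.
Qed.

Lemma conjc_chiE a b : conjc (chi a b) = chi (- a) b.
Proof.
by rewrite -[RHS]mul1r -(conjc_chi a b) -mulrA -chiDl subrr chi0l mulr1.
Qed.

(** For nonzero [a] this is a geometric sum whose ratio [w] has angle strictly between 0 and
    [2 * pi]. Thus [w] differs from 1 while [w ^+ N = 1], and the sum vanishes. *)
Lemma sum_chi (a : 'I_N) : \sum_b chi a b = (N%:R *+ (a == 0)) :> R[i].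
Proof.
have [->|a0] := eqVneq a 0.
  by rewrite (eq_bigr (fun=> 1)) => [|b _]; rewrite ?chi0l // sumr_const card_ord.
have a_gt0 : (0 < a)%N.
  by rewrite lt0n; apply: contra a0 => /eqP a0; apply/eqP/val_inj.
set w := expi (2 * pi / N%:R : R) ^+ a.
have w1 : w != 1.
  rewrite /w -expiMn; apply: expi_neq1; rewrite -[_ *+ a]mulr_natr; apply/andP; split.
    by rewrite !mulr_gt0 ?invr_gt0 ?ltr0n ?pi_gt0.
  rewrite -mulrA gtr_pMr ?mulr_gt0 ?pi_gt0 //.
  by rewrite mulrC ltr_pdivrMr ?ltr0n // mul1r ltr_nat.
have : (w - 1) * (\sum_b chi a b) = 0.
  under eq_bigr do rewrite /chi exprM -/w.
  by rewrite -subrX1 /w exprAC expi_root_unity expr1n subrr.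
by move/eqP; rewrite mulf_eq0 subr_eq0 (negPf w1) => /eqP.
Qed.

(** Expand the squared modulus into a double sum over [m] and [m'] and sum over [k] first: by
    orthogonality only the diagonal survives, with weight [N]. *)
Lemma parseval_chi (a : 'I_N -> R[i]) :
  \sum_k normc (\sum_m a m * chi m k) ^+ 2 = N%:R * \sum_m normc (a m) ^+ 2.
Proof.
(* The identity between reals is moved into [R[i]], where the squared modulus factors as
   [z * conjc z]. *)
apply: (fmorph_inj (@real_complex R)).
rewrite rmorph_sum rmorphM rmorph_sum rmorph_nat /=.
under eq_bigr => k _.
  rewrite [(_ ^+ 2)%:C]sqr_normcE rmorph_sum mulr_suml.
  under eq_bigr do rewrite mulr_sumr.
  over.
rewrite exchange_big mulr_sumr; apply: eq_bigr => m _.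
rewrite exchange_big (bigD1 m) //= [X in _ + X]big1 => [|m' m'm].
  rewrite addr0 sqr_normcE mulr_natl.
  rewrite (eq_bigr (fun=> a m * conjc (a m))) => [|k _].
    by rewrite sumr_const card_ord.
  by rewrite conjcM mulrACA [chi m k * _]mulrC conjc_chi mulr1.
rewrite (eq_bigr (fun k => a m * conjc (a m') * chi (m - m') k)) => [|k _].
  by rewrite -mulr_sumr sum_chi subr_eq0 eq_sym (negPf m'm) mulr0n mulr0.
by rewrite conjcM mulrACA chiDl conjc_chiE.
Qed.

(** * The ambiguity function in the time and frequency domains *)

Lemma ofdmE (s : 'cV[R[i]]_N) m :
  ofdm s m 0 = ((Num.sqrt N%:R)^-1)%:C * \sum_k s k 0 * chi k m.
Proof.
rewrite /ofdm mxE mulr_sumr; apply: eq_bigr => k _; rewrite !mxE.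
rewrite conjcM conjc_real conjc_expi opprK chiE; ring.
Qed.

(** Replaces the integer remainder by subtraction in ['I_N], so that the shift can interact with
    [chiDl]. *)
Lemma shift_mxE (k a b : 'I_N) : shift_mx R k a b = (b == a - k)%:R.
Proof.
rewrite mxE; congr (_%:R); congr nat_of_bool.
have -> : ((a%:Z - k%:Z) %% N%:Z)%Z = (a - k : 'I_N)%R%:Z.
  (* Subtraction in ['I_N] is computed as adding [N - k] and reducing; the extra [N] disappears
     modulo [N]. *)
  have -> : (a%:Z - k%:Z = (a + (N - k))%N%:Z - N%:Z)%R.
    by rewrite PoszD -subzn ?(ltnW (ltn_ord k)) //; lia.
  by rewrite -[in LHS](modzDr _ N%:Z) subrK modz_nat /= modnDmr.
by rewrite eqz_nat.
Qed.

Lemma dp_af_time (x : 'cV[R[i]]_N) (k q : 'I_N) :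
  dp_af x k q = \sum_m conjc (x (m - k) 0) * conjc (chi q m) * x m 0.
Proof.
rewrite /dp_af mxE; apply: eq_bigr => m _; congr (_ * _).
rewrite map_diag_mx mul_mx_diag !mxE -chiE; congr (_ * _).
rewrite (eq_bigr (fun i => conjc (x i 0) * (i == m - k)%:R)) => [|i _].
  rewrite (bigD1 (m - k)) //= big1 => [|i /negPf ->]; rewrite ?mulr0 //.
  by rewrite eqxx mulr1 addr0.
by rewrite [herm_tr x 0 i]mxE [x^T _ _]mxE [(shift_mx R k)^T i m]mxE shift_mxE.
Qed.

Lemma dp_af_freq (s : 'cV[R[i]]_N) (k q : 'I_N) :
  dp_af (ofdm s) k q = \sum_m (conjc (s m 0) * s (m + q) 0) * chi m k.
Proof.
rewrite dp_af_time; set c := ((Num.sqrt (N%:R : R))^-1)%:C.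
have c2 : c * c * N%:R = 1.
  rewrite /c -rmorphM -invfM -expr2 sqr_sqrtr ?ler0n // -(rmorph_nat (@real_complex R)).
  by rewrite -rmorphM mulVf ?pnatr_eq0.
(* Both copies of the signal are expanded over frequencies, [a] for the conjugated one and [b] for
   the other; everything depending on the time [m] collects into one character. *)
transitivity (\sum_m \sum_a \sum_b (c * c * conjc (s a 0) * s b 0 * chi a k) *
    chi (b - a - q) m).
  apply: eq_bigr => m _; rewrite !ofdmE -/c conjcM conjc_real -/c rmorph_sum /=.
  rewrite mulr_sumr !mulr_suml; apply: eq_bigr => a _.
  rewrite !mulr_sumr; apply: eq_bigr => b _.
  rewrite conjcM (chiC a) [conjc (chi _ _)]conjc_chiE opprB chiDl.
  rewrite [conjc (chi _ _)]conjc_chiE !chiDl.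
  have -> : chi (- m) a = chi (- a) m by rewrite -!conjc_chiE chiC.
  by rewrite (chiC k a); ring.
rewrite exchange_big; apply: eq_bigr => a _.
(* Summing over time first leaves only [b = a + q], and the resulting factor [N] cancels the two
   normalizations by [c2]. *)
rewrite exchange_big (bigD1 (a + q)) //= [X in _ + X]big1 => [|b bne].
  rewrite -mulr_sumr [a + q]addrC addrK subrr sum_chi eqxx mulr1n addr0.
  by rewrite -[RHS]mul1r -[X in _ = X * _]c2; ring.
by rewrite -mulr_sumr sum_chi -addrA -opprD subr_eq0 (negPf bne) mulr0n mulr0.
Qed.

Lemma sum_dp_af (s : 'cV[R[i]]_N) (q : 'I_N) :
  \sum_k normc (dp_af (ofdm s) k q) ^+ 2 =
  N%:R * \sum_m normc (s m 0) ^+ 2 * normc (s (m + q) 0) ^+ 2.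
Proof.
under eq_bigr do rewrite dp_af_freq.
rewrite parseval_chi; congr (_ * _); apply: eq_bigr => m _.
rewrite normcM exprMn; congr (_ * _).
by case: (s m 0) => a b; rewrite /normc /= sqrrN.
Qed.

End characters.

(** * Expectation of a product of independent nonnegative variables *)

Section independent_product.
Local Open Scope ereal_scope.
Context d d1 d2 (T : measurableType d) (T1 : measurableType d1)
  (T2 : measurableType d2) (R : realType) (P : probability T R).

(** Independence makes the law of the pair the product of the two laws, and Tonelli then splits the
    integral. *)
Lemma ge0_integralM_indep (X : {mfun T >-> T1}) (Y : {mfun T >-> T2})
    (f : T1 -> \bar R) (g : T2 -> \bar R) :
  (forall A B, measurable A -> measurable B ->
    P (X @^-1` A `&` Y @^-1` B) = P (X @^-1` A) * P (Y @^-1` B)) ->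
  measurable_fun [set: T1] f -> measurable_fun [set: T2] g ->
  (forall x, 0 <= f x) -> (forall y, 0 <= g y) ->
  \int[P]_t (f (X t) * g (Y t)) = \int[P]_t f (X t) * \int[P]_t g (Y t).
Proof.
move=> indep mf mg f0 g0.
have mXY : measurable_fun [set: T] (fun t => (X t, Y t)).
  exact: measurable_fun_pair.
pose XY : {mfun T >-> (T1 * T2)%type} := HB.pack (fun t => (X t, Y t))
  (isMeasurableFun.Build _ _ _ _ _ mXY).
pose h (z : T1 * T2) := f z.1 * g z.2.
have mh : measurable_fun setT h.
  by apply: emeasurable_funM; [exact: (measurableT_comp mf)|exact: (measurableT_comp mg)].
have h0 z : 0 <= h z by rewrite mule_ge0.
rewrite -[LHS]/(\int[P]_t (h \o XY) t) -ge0_integral_distribution //.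
(* The two measures agree on rectangles by [indep], which determines them on all measurable sets. *)
rewrite (eq_measure_integral (distribution P X \x distribution P Y)); last first.
  by move=> A mA _; apply/esym; apply: product_measure_unique.
rewrite fubini_tonelli1 // /fubini_F.
rewrite (eq_integral (fun x => f x * \int[distribution P Y]_y g y)); last first.
  by move=> x _; rewrite /h /= ge0_integralZl.
rewrite ge0_integralZr //; last exact: integral_ge0.
by rewrite !ge0_integral_distribution.
Qed.

End independent_product.

(** * Measurability of complex random variables *)

Section complex_rv_closure.
Context d (T : measurableType d) (R : realType).
Implicit Types X Y : T -> R[i].

Lemma complex_rvP X : complex_rv X <->
  measurable_fun [set: T] (fun t => complex.Re (X t) : measurableTypeR R) /\
  measurable_fun [set: T] (fun t => complex.Im (X t) : measurableTypeR R).
Proof. exact: measurable_fun_pairP. Qed.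

Lemma complex_rv_cst (z : R[i]) : complex_rv (fun _ : T => z).
Proof. by apply/complex_rvP; split; exact: measurable_cst. Qed.

Lemma complex_rvD X Y : complex_rv X -> complex_rv Y ->
  complex_rv (fun t => X t + Y t).
Proof.
move=> /complex_rvP[X1 X2] /complex_rvP[Y1 Y2]; apply/complex_rvP; split.
- apply: (eq_measurable_fun (fun t => complex.Re (X t) + complex.Re (Y t))).
    by move=> t _; case: (X t) (Y t) => [? ?] [].
  exact: measurable_funD.
- apply: (eq_measurable_fun (fun t => complex.Im (X t) + complex.Im (Y t))).
    by move=> t _; case: (X t) (Y t) => [? ?] [].
  exact: measurable_funD.
Qed.

Lemma complex_rvM X Y : complex_rv X -> complex_rv Y ->
  complex_rv (fun t => X t * Y t).
Proof.
move=> /complex_rvP[X1 X2] /complex_rvP[Y1 Y2]; apply/complex_rvP; split.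
- apply: (eq_measurable_fun (fun t => complex.Re (X t) * complex.Re (Y t)
      - complex.Im (X t) * complex.Im (Y t))).
    by move=> t _; case: (X t) (Y t) => [? ?] [].
  by apply: measurable_funB; apply: measurable_funM.
- apply: (eq_measurable_fun (fun t => complex.Re (X t) * complex.Im (Y t)
      + complex.Im (X t) * complex.Re (Y t))).
    by move=> t _; case: (X t) (Y t) => [? ?] [].
  by apply: measurable_funD; apply: measurable_funM.
Qed.

Lemma complex_rv_conj X : complex_rv X -> complex_rv (fun t => conjc (X t)).
Proof.
move=> /complex_rvP[X1 X2]; apply/complex_rvP; split.
- by apply: (eq_measurable_fun _ _ X1) => t _; case: (X t).
- apply: (eq_measurable_fun (fun t => - complex.Im (X t))).
    by move=> t _; case: (X t).
  exact: measurable_funN.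
Qed.

Lemma complex_rv_sum (I : Type) (r : seq I) (X : I -> T -> R[i]) :
  (forall i, complex_rv (X i)) -> complex_rv (fun t => \sum_(i <- r) X i t).
Proof.
move=> mX; elim: r => [|i r IH].
  under eq_fun do rewrite big_nil; exact: complex_rv_cst.
under eq_fun do rewrite big_cons; exact: complex_rvD.
Qed.

(** The squared modulus as a Borel function on pairs, since equality in law and independence are
    both stated through [reim]. *)
Definition sqnorm (z : measurableTypeR R * measurableTypeR R) : R :=
  (z.1 : R) ^+ 2 + (z.2 : R) ^+ 2.

Lemma measurable_sqnorm : measurable_fun setT sqnorm.
Proof. by apply: measurable_funD; apply: measurable_funX. Qed.

Lemma sqnorm_ge0 z : 0 <= sqnorm z.
Proof. by rewrite addr_ge0 ?sqr_ge0. Qed.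

Lemma sqnorm_reim X t : sqnorm (reim X t) = normc (X t) ^+ 2.
Proof.
rewrite /sqnorm /reim /normc; case: (X t) => a b /=.
by rewrite sqr_sqrtr // addr_ge0 ?sqr_ge0.
Qed.

Lemma measurable_sqr_normc X : complex_rv X ->
  measurable_fun [set: T] (fun t => normc (X t) ^+ 2).
Proof.
move=> mX; under eq_fun do rewrite -sqnorm_reim.
exact: (measurableT_comp measurable_sqnorm).
Qed.

End complex_rv_closure.

(** * Second moments under equality in law and under independence *)

Section second_moments.
Local Open Scope ereal_scope.
Context (R : realType).

Lemma expectation_sqr_normc_same_distribution d1 (T1 : measurableType d1) d2
    (T2 : measurableType d2) (P1 : probability T1 R) (P2 : probability T2 R)
    (X1 : T1 -> R[i]) (X2 : T2 -> R[i]) :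
  complex_rv X1 -> complex_rv X2 -> same_distribution P1 P2 X1 X2 ->
  'E_P1[fun t => (normc (X1 t) ^+ 2)%R] = 'E_P2[fun t => (normc (X2 t) ^+ 2)%R].
Proof.
move=> m1 m2 X12; rewrite unlock.
under eq_integral do rewrite -sqnorm_reim.
under [RHS]eq_integral do rewrite -sqnorm_reim.
pose Y1 : {mfun T1 >-> _} := HB.pack (reim X1) (isMeasurableFun.Build _ _ _ _ _ m1).
pose Y2 : {mfun T2 >-> _} := HB.pack (reim X2) (isMeasurableFun.Build _ _ _ _ _ m2).
have mq : measurable_fun setT (EFin \o @sqnorm R).
  by apply/measurable_EFinP; exact: measurable_sqnorm.
have q0 z : 0 <= (EFin \o @sqnorm R) z by rewrite lee_fin sqnorm_ge0.
rewrite -[LHS]/(\int[P1]_t ((EFin \o @sqnorm R) \o Y1) t).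
rewrite -[RHS]/(\int[P2]_t ((EFin \o @sqnorm R) \o Y2) t).
rewrite -!ge0_integral_distribution //.
by apply: eq_measure_integral => A mA _; exact: X12.
Qed.

Context d (T : measurableType d) (P : probability T R).

Lemma expectation_sqr_normcM (I : finType) (D : {set I}) (X : I -> T -> R[i])
    (i j : I) : i \in D -> j \in D -> i != j ->
  complex_rv (X i) -> complex_rv (X j) -> mutually_independent P D X ->
  'E_P[fun t => (normc (X i t) ^+ 2 * normc (X j t) ^+ 2)%R] =
  'E_P[fun t => (normc (X i t) ^+ 2)%R] * 'E_P[fun t => (normc (X j t) ^+ 2)%R].
Proof.
move=> iD jD ij mi mj indep; rewrite unlock.
pose Yi : {mfun T >-> _} := HB.pack (reim (X i)) (isMeasurableFun.Build _ _ _ _ _ mi).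
pose Yj : {mfun T >-> _} := HB.pack (reim (X j)) (isMeasurableFun.Build _ _ _ _ _ mj).
have mq : measurable_fun setT (EFin \o @sqnorm R).
  by apply/measurable_EFinP; exact: measurable_sqnorm.
have q0 z : 0 <= (EFin \o @sqnorm R) z by rewrite lee_fin sqnorm_ge0.
have ind A B : measurable A -> measurable B ->
    P (Yi @^-1` A `&` Yj @^-1` B) = P (Yi @^-1` A) * P (Yj @^-1` B).
  move=> mA mB.
  (* Mutual independence is applied to the two-element subfamily; with this choice of events the
     intersection over it is the rectangle event for [A] and [B]. *)
  have := indep [set i; j]%SET (fun k => if k == i then A else B).
  rewrite big_setU1 ?inE //= big_set1 eqxx eq_sym (negPf ij) => <-.
  - congr (P _); apply/seteqP; split=> t /=.
      move=> [tA tB] k /=; rewrite !inE => /orP[] /eqP ->; rewrite ?eqxx //.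
      by rewrite eq_sym (negPf ij).
    move=> h; split; first by have := h i; rewrite /= !inE eqxx; apply.
    by have := h j; rewrite /= !inE eqxx orbT eq_sym (negPf ij); apply.
  - by apply/fintype.subsetP => k; rewrite !inE => /orP[] /eqP ->.
  - by move=> k; case: ifP.
have := ge0_integralM_indep ind mq mq q0 q0.
rewrite /Yi /Yj /=.
under eq_integral do rewrite !sqnorm_reim -EFinM.
under [X in _ = X * _]eq_integral do rewrite sqnorm_reim.
under [X in _ = _ * X]eq_integral do rewrite sqnorm_reim.
by [].
Qed.

End second_moments.

(** * Averaging the pointwise Parseval identity over the data symbols *)

Theorem corollary1 (R : realType)
  (dT : measure_display) (T : measurableType dT) (P : probability T R)
  (dT' : measure_display) (T' : measurableType dT') (P' : probability T' R)
  (N L : nat) (hN : (1 <= N)%N) (hL : (L <= N)%N)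
  (I : {set 'I_N}) (hI : #|I| = L)
  (s : T -> 'cV[R[i]]_N)
  (p : 'I_N -> R[i])
  (hp : forall i, i \in I -> normc (p i) = 1)
  (s_pilot : forall i, i \in I -> forall t, s t i 0 = p i)
  (d : T' -> R[i]) (d_rv : complex_rv d)
  (d_moment4 : ('E_P'[fun t => (normc (d t) ^+ 4)%R] < +oo)%E)
  (d_mean : cexpectation P' d = 0)
  (d_power : ('E_P'[fun t => (normc (d t) ^+ 2)%R] = 1)%E)
  (d_square : cexpectation P' (fun t => d t ^+ 2) = 0)
  (d_cubic : cexpectation P' (fun t => d t * (normc (d t) ^+ 2)%:C) = 0)
  (d_cubic_conj :
     cexpectation P' (fun t => conjc (d t) * (normc (d t) ^+ 2)%:C) = 0)
  (s_rv : forall i, i \notin I -> complex_rv (fun t => s t i 0))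
  (s_distr : forall i, i \notin I ->
     same_distribution P P' (fun t => s t i 0) d)
  (s_indep : mutually_independent P (~: I)%SET (fun i t => s t i 0)) :
  forall q : 'I_N, nat_of_ord q <> 0%N ->
    (\sum_(k < N) 'E_P[fun t => (normc (dp_af (ofdm (s t)) k q) ^+ 2)%R]
     = (N ^ 2)%:R%:E)%E.
Proof.
(* Writing [N] as a successor gives ['I_N] its addition modulo [N]. *)
move=> q q0; case: N q hN hL I hI s p hp s_pilot s_rv s_distr s_indep q0
  => // n q _ _ {}I _ {}s {}p {}hp {}s_pilot {}s_rv {}s_distr {}s_indep q0.
have q_neq0 : q != 0 by apply/eqP => q_eq0; apply: q0; rewrite q_eq0.
have rv_s i : complex_rv (fun t => s t i 0).
  have [iI|/s_rv //] := boolP (i \in I).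
  by under eq_fun do rewrite s_pilot //; exact: complex_rv_cst.
have rv_af k : complex_rv (fun t => dp_af (ofdm (s t)) k q).
  under eq_fun do rewrite dp_af_freq.
  apply: complex_rv_sum => m; apply: complex_rvM; last exact: complex_rv_cst.
  by apply: complex_rvM => //; exact: complex_rv_conj.
have pilot_norm i t : i \in I -> normc (s t i 0) ^+ 2 = 1.
  by move=> iI; rewrite s_pilot // hp // expr1n.
have power i : ('E_P[fun t => (normc (s t i 0) ^+ 2)%R] = 1)%E.
  have [iI|iI] := boolP (i \in I).
    by under eq_fun do rewrite pilot_norm //; exact: expectation_cst.
  rewrite -d_power.
  apply: (expectation_sqr_normc_same_distribution _ d_rv); [exact: rv_s|exact: s_distr].
(* A pilot at either index contributes the constant factor 1 and reduces the claim to [power];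
   independence enters when both indices carry data. *)
have power2 i j : i != j ->
    ('E_P[fun t => (normc (s t i 0) ^+ 2 * normc (s t j 0) ^+ 2)%R] = 1)%E.
  move=> ij; have [iI|iI] := boolP (i \in I).
    by under eq_fun do rewrite pilot_norm // mul1r; exact: power.
  have [jI|jI] := boolP (j \in I).
    by under eq_fun do rewrite (pilot_norm j) // mulr1; exact: power.
  rewrite (expectation_sqr_normcM _ _ ij (rv_s i) (rv_s j) s_indep) ?inE //.
  by rewrite !power mul1e.
have m2 i : measurable_fun setT (fun t => normc (s t i 0) ^+ 2).
  exact: measurable_sqr_normc.
(* Nonnegativity allows the sum over [k] to move inside the expectation, where [sum_dp_af] applies
   for each outcome; the sum over [m] is then moved back out. *)
under eq_bigr do rewrite unlock.
rewrite -ge0_integral_sum //; last 2 first.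
- by move=> k; apply/measurable_EFinP; exact: measurable_sqr_normc.
- by move=> k t _; rewrite lee_fin sqr_ge0.
under eq_integral do rewrite sumEFin sum_dp_af EFinM -sumEFin.
rewrite ge0_integralZl //; last 2 first.
- apply: emeasurable_sum => m; apply/measurable_EFinP.
  exact: measurable_funM.
- by move=> t _; apply: sume_ge0 => m _; rewrite lee_fin mulr_ge0 ?sqr_ge0.
rewrite ge0_integral_sum //; last 2 first.
- by move=> m; apply/measurable_EFinP; exact: measurable_funM.
- by move=> m t _; rewrite lee_fin mulr_ge0 ?sqr_ge0.
(* Each of the [N] terms is 1 since [q] is nonzero; with the Parseval factor [N] this gives the
   square. *)
rewrite (eq_bigr (fun=> 1%E)) => [|m _]; last first.
  have /power2 : m != m + q by rewrite -[X in X != _]addr0 (inj_eq (addrI m)) eq_sym.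
  by rewrite unlock.
by rewrite sumEFin sumr_const card_ord -EFinM -natrM.
Qed.
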